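(* $p_{\mathrm{max}}(\mathbb{Z}^2)\le 0.8457$.
   Context: $\mathbb{Z}^2$ denotes the lattice graph: its vertices are the points with integer coordinates, and two vertices are adjacent iff they are at Euclidean distance $1$. A bond percolation model on a (possibly infinite) graph $G$ is a probability distribution on the spanning subgraphs of $G$; an edge is open if it is present in the random subgraph and closed otherwise. The model is 1-independent if, for any two disjoint sets of edges $S_1$, $S_2$ of $G$ such that no edge in $S_1$ shares a vertex with an edge in $S_2$, the states (open or closed) of the edges in $S_1$ are independent of the states of the edges in $S_2$. A model on an infinite graph percolates if the random subgraph has an infinite component with positive probability. $\mathcal{D}_{\ge p}(G)$ is the class of 1-independent bond percolation models on $G$ in which each edge is open with probability at least $p$, and $$p_{\mathrm{max}}(G)=\sup\{p : \text{some model in } \mathcal{D}_{\ge p}(G) \text{ does not percolate}\}.$$ *)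

(* Defs.v *)
From HB Require Import structures.
From mathcomp Require Import all_boot all_order all_algebra.
From mathcomp Require Import all_classical all_reals all_analysis.
Set Implicit Arguments.
Unset Strict Implicit.
Unset Printing Implicit Defensive.
Import Order.TTheory GRing.Theory Num.Theory.
Local Open Scope classical_set_scope.
Local Open Scope ring_scope.

(* Vertices are countable so that [percolation_event] below is measurable;
   values of a measure on non-measurable sets are meaningless in the library. *)
Record graph := Graph {
  vertex :> countType;
  adj : rel vertex;
  adj_sym : symmetric adj;
  adj_irr : irreflexive adj }.

Definition edges (G : graph) : set (set G) :=
  [set e | exists u v : G, adj u v /\ e = [set u; v]].

Definition edge (G : graph) := set_type (@edges G).

(* A spanning subgraph of G is identified with its set of (open) edges. *)
Definition subgraph (G : graph) := set (edge G).

Definition edge_open (G : graph) (e : edge G) : set (subgraph G) :=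
  [set w | w e].

Definition edge_events (G : graph) (S : set (edge G)) :
    set (set (subgraph G)) :=
  [set edge_open e | e in S].

(* The spanning subgraphs with the product sigma-algebra. *)
Definition subgraph_space (G : graph) :=
  g_sigma_algebraType (@edge_events G [set: edge G]).

Definition bond_model (R : realType) (G : graph) :=
  probability (subgraph_space G) R.

Definition one_independent (R : realType) (G : graph) (P : bond_model R G) :=
  forall S1 S2 : set (edge G),
    S1 `&` S2 = set0 ->
    (forall e f, S1 e -> S2 f -> val e `&` val f = set0) ->
    forall A B : set (subgraph G),
      <<s edge_events S1 >> A -> <<s edge_events S2 >> B ->
      P (A `&` B) = (P A * P B)%E.

Definition open_adj (G : graph) (w : subgraph G) (u v : G) : Prop :=
  exists2 e : edge G, w e & val e = [set u; v].

Definition component (G : graph) (w : subgraph G) (u : G) : set G :=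
  [set v | exists2 s : seq G,
     path (fun x y => `[< open_adj w x y >]) u s & last u s = v].

Definition percolation_event (G : graph) : set (subgraph G) :=
  [set w | exists u : G, infinite_set (component w u)].

Definition percolates (R : realType) (G : graph) (P : bond_model R G) : Prop :=
  (0 < P (@percolation_event G))%E.

Definition D_ge (R : realType) (G : graph) (p : R) : set (bond_model R G) :=
  [set P | one_independent P /\ forall e : edge G, (p%:E <= P (edge_open e))%E].

(* The supremum is taken in \bar R, where it needs no side condition. *)
Definition p_max (R : realType) (G : graph) : \bar R :=
  ereal_sup [set p%:E | p in
    [set p : R | exists2 P : bond_model R G, D_ge p P & ~ percolates P]].

(* (Squared) Euclidean distance equal to 1. *)
Definition Z2_adj : rel (int * int) :=
  fun u v => (u.1 - v.1) ^+ 2 + (u.2 - v.2) ^+ 2 == 1.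

Lemma Z2_adj_sym : symmetric Z2_adj.
Proof.
by move=> u v; rewrite /Z2_adj -[u.1 - v.1]opprB -[u.2 - v.2]opprB !sqrrN.
Qed.

Lemma Z2_adj_irr : irreflexive Z2_adj.
Proof. by move=> u; rewrite /Z2_adj !subrr. Qed.

Definition Z2 : graph := Graph Z2_adj_sym Z2_adj_irr.

(* Main.v *)
(* Peierls argument in which the dual path is replaced by a sparser chain of
   last exits. Suppose that all open clusters are finite, let A be the union of
   the clusters of (0,0), ..., (N,0), and let m >= N be the largest abscissa of
   A on the horizontal axis. A parity argument yields a path of faces that
   starts across the boundary edge {(m,0), (m+1,0)}, crosses only boundary
   edges of A, hence closed edges, and ends in the half-plane x < 0. Select
   crossings along this path: from each selected crossing, the next one is the
   last exit of the path from the six faces touching the end points of the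
   selected edge. Consecutive selections are related by one of ten moves, at
   least m of them occur, and the selected edges are pairwise
   vertex-disjoint, so by 1-independence n + 1 given edges are all closed with
   probability at most q^(n+1), where q = 1 - p. Each selected crossing must
   avoid the neighbourhoods of all previous ones; using this for three
   consecutive moves already bounds the number of chains by C 6.4^n. Since
   6.4 * 0.1543 < 1, Borel-Cantelli concludes. *)
From HB Require Import structures.
Require Import Defs.
From mathcomp Require Import all_boot all_order all_algebra.
From mathcomp Require Import all_classical all_reals all_analysis.
From mathcomp Require Import zify ring lra.
Import Order.TTheory GRing.Theory Num.Theory.
Import numFieldNormedType.Exports.
Set Implicit Arguments.
Unset Strict Implicit.
Unset Printing Implicit Defensive.
Local Open Scope classical_set_scope.
Local Open Scope ring_scope.

(** * Darts, their zones and the ten exit moves *)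

Definition pt := (int * int)%type.
Definition addp (u v : pt) : pt := (u.1 + v.1, u.2 + v.2).
Definition mulp (u v : pt) : pt := (u.1 * v.1 - u.2 * v.2, u.1 * v.2 + u.2 * v.1).

Definition units : seq pt := [:: (1, 0); (0, 1); (-1, 0); (0, -1)].

(* A dart [(f, d)] is the crossing from the face [f] to the face [f + d]; the
   face [f] is the unit square whose lower left corner is the vertex [f]. *)
Definition dart := (pt * pt)%type.
Definition tgt (m : dart) : pt := addp m.1 m.2.
(* [g] read in the frame of [m]: points are Gaussian integers, and the group
   of rotations and translations acts by [z |-> m.1 + m.2 z]. *)
Definition act (m g : dart) : dart := (addp m.1 (mulp m.2 g.1), mulp m.2 g.2).

Definition box (x y : int) : bool := (0 <= x <= 1) && (-1 <= y <= 1).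
(* The six faces incident to an end point of the edge crossed by [m]. *)
Definition zone (m : dart) (f : pt) : bool :=
  box ((f.1 - m.1.1) * m.2.1 + (f.2 - m.1.2) * m.2.2)
      ((f.2 - m.1.2) * m.2.1 - (f.1 - m.1.1) * m.2.2).

Definition dart0 : dart := ((0, 0), (1, 0)).

(* All darts from a face of [zone dart0] to a face outside it. *)
Definition moves : seq dart :=
  [:: ((1, -1), (1, 0)); ((1, 0), (1, 0)); ((1, 1), (1, 0));
      ((0, 1), (0, 1)); ((1, 1), (0, 1));
      ((0, -1), (0, -1)); ((1, -1), (0, -1));
      ((0, -1), (-1, 0)); ((0, 0), (-1, 0)); ((0, 1), (-1, 0))].

Definition move (k : nat) : dart := nth dart0 moves k.

Definition off (m m' : dart) : bool := ~~ zone m m'.1 && ~~ zone m (tgt m').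

(** * Counting the admissible sequences of moves *)

Definition ok2 (i j : nat) : bool := off dart0 (act (move i) (move j)).
Definition ok3 (i j k : nat) : bool :=
  [&& ok2 i j, ok2 j k & off dart0 (act (act (move i) (move j)) (move k))].

(* An approximate Perron eigenvector, found numerically, of the matrix of
   transitions [(i, j) -> (j, k)] allowed by [ok3]; [weight_step] certifies that
   the spectral radius is at most 32/5. *)
Definition weights : seq (seq nat) :=
  [:: [:: 10; 8; 9; 1; 8; 10; 11; 8; 1; 1];
      [:: 10; 8; 10; 1; 11; 1; 11; 1; 1; 1];
      [:: 9; 8; 10; 10; 11; 1; 8; 1; 1; 8];
      [:: 10; 8; 10; 10; 11; 1; 11; 1; 1; 8];
      [:: 10; 8; 10; 1; 11; 10; 11; 8; 1; 1];
      [:: 10; 8; 10; 1; 11; 10; 11; 8; 1; 1];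
      [:: 10; 8; 10; 10; 11; 1; 11; 1; 1; 8];
      [:: 9; 8; 10; 10; 11; 1; 8; 1; 1; 8];
      [:: 10; 8; 10; 1; 11; 1; 11; 1; 1; 1];
      [:: 10; 8; 9; 1; 8; 10; 11; 8; 1; 1]]%N.

(** The default value 1 keeps weights positive outside the table as well. *)
Definition weight (i j : nat) : nat := nth 1 (nth [::] weights i) j.

Lemma weight_gt0 i j : (0 < weight i j)%N.
Proof.
have H : all (all (ltn 0)) weights by [].
rewrite /weight; case: (ltnP i (size weights)) => hi; last by rewrite (nth_default _ hi) nth_nil.
have {}H := all_nthP [::] H i hi.
by case: (ltnP j (size (nth [::] weights i))) => hj; [exact: (all_nthP 1%N H) | rewrite nth_default].
Qed.

Lemma weight_le i j : (weight i j <= 11)%N.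
Proof.
have H : all (all (fun x => x <= 11)%N) weights by [].
rewrite /weight; case: (ltnP i (size weights)) => hi; last by rewrite (nth_default _ hi) nth_nil.
have {}H := all_nthP [::] H i hi.
by case: (ltnP j (size (nth [::] weights i))) => hj; [exact: (all_nthP 1%N H) | rewrite nth_default].
Qed.

Arguments ok3 : simpl never.
Arguments ok2 : simpl never.

Lemma weight_step i j : (i < 10)%N -> (j < 10)%N ->
  (5 * sumn [seq weight j k | k <- iota 0 10 & ok3 i j k] <= 32 * weight i j)%N.
Proof.
move=> hi hj.
have H : all (fun i => all (fun j =>
  5 * sumn [seq weight j k | k <- iota 0 10 & ok3 i j k] <= 32 * weight i j)%N
  (iota 0 10)) (iota 0 10) by vm_compute.
by have /allP/(_ i) := H; rewrite mem_iota => /(_ hi) /allP/(_ j); rewrite mem_iota => /(_ hj).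
Qed.

Fixpoint words (n i j : nat) : seq (seq nat) :=
  if n is n'.+1 then
    flatten [seq [seq k :: w | w <- words n' j k] | k <- iota 0 10 & ok3 i j k]
  else [:: [::]].

(** [weight] is a supersolution of the transfer recursion for the factor 32/5 ([weight_step]). Being
    at least 1, it dominates the count for [n = 0], and the recursion preserves this domination. *)
Lemma size_words n i j : (i < 10)%N -> (j < 10)%N ->
  (5 ^ n * size (words n i j) <= 32 ^ n * weight i j)%N.
Proof.
elim: n i j => [|n IHn] i j hi hj; first by rewrite !mul1n weight_gt0.
have -> : size (words n.+1 i j) =
    \sum_(k <- [seq k <- iota 0 10 | ok3 i j k]) size (words n j k).
  rewrite [words _ _ _]/(flatten _) size_flatten /shape -map_comp sumnE big_map.
  by apply: eq_bigr => k _; rewrite [LHS]size_map.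
apply: (@leq_trans (32 ^ n * (5 * \sum_(k <- [seq k <- iota 0 10 | ok3 i j k]) weight j k))%N).
  rewrite expnS -mulnA [X in (_ <= X)%N]mulnCA leq_pmul2l // !big_distrr !big_filter.
  rewrite big_seq_cond [X in (_ <= X)%N]big_seq_cond; apply: leq_sum => k /andP[+ _].
  by rewrite mem_iota => /andP[_ hk]; apply: IHn.
rewrite expnSr -mulnA leq_pmul2l ?expn_gt0 //.
by have := weight_step hi hj; rewrite sumnE big_map.
Qed.

(** * Invariance under rotations and translations *)

Lemma pt_eq (u v : pt) : u.1 = v.1 -> u.2 = v.2 -> u = v.
Proof. by case: u v => [? ?] [? ?] /= -> ->. Qed.

Lemma zone_frame (m : dart) z : m.2 \in units ->
  zone m (addp m.1 (mulp m.2 z)) = zone dart0 z.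
Proof.
case: m z => [[a b] d] [x y]; rewrite /= !inE => /or4P[] /eqP ->;
  by rewrite /zone /=; congr box; ring.
Qed.

Lemma act_assoc m g h : act (act m g) h = act m (act g h).
Proof.
case: m g h => [[a b] [c d]] [[e f] [g h]] [[i j] [k l]].
by rewrite /act /addp /mulp /=; congr ((_, _), (_, _)); ring.
Qed.

Lemma tgt_act m g : tgt (act m g) = addp m.1 (mulp m.2 (tgt g)).
Proof.
case: m g => [[a b] [c d]] [[e f] [g h]].
by rewrite /tgt /act /addp /mulp /=; congr (_, _); ring.
Qed.

Lemma off_frame m g : m.2 \in units -> off m (act m g) = off dart0 g.
Proof. by move=> hm; rewrite /off tgt_act /= !zone_frame. Qed.

Lemma act_unit m g : m.2 \in units -> g.2 \in units -> (act m g).2 \in units.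
Proof.
case: m g => [p d] [r e]; rewrite /= !inE.
by move=> /or4P[] /eqP -> /or4P[] /eqP ->.
Qed.

Lemma act_frame (m m' : dart) : m.2 \in units -> m'.2 \in units ->
  exists2 g : dart, m' = act m g & g.2 \in units.
Proof.
(* On [units] the conjugate is the inverse, so this is [m'] pulled back by the motion attached to
   [m]. *)
pose conj (d : pt) : pt := (d.1, - d.2).
move=> hm hm'.
exists (mulp (conj m.2) (m'.1.1 - m.1.1, m'.1.2 - m.1.2), mulp (conj m.2) m'.2).
  rewrite /act; case: m m' hm hm' => [[a b] d] [[a' b'] d']; rewrite /= !inE.
  by move=> /or4P[] /eqP -> /or4P[] /eqP ->; rewrite /addp /mulp /=;
     congr ((_, _), (_, _)); ring.
case: m m' hm hm' => [[a b] d] [[a' b'] d']; rewrite /= !inE.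
by move=> /or4P[] /eqP -> /or4P[] /eqP ->.
Qed.

(** In the frame of [m] this is a finite check: six faces of the zone, four directions, and the
    exits among them are the entries of [moves]. *)
Lemma exit_move (m m' : dart) : m.2 \in units -> m'.2 \in units ->
  zone m m'.1 -> ~~ zone m (tgt m') -> exists2 k, (k < 10)%N & m' = act m (move k).
Proof.
move=> hm hm'; have [g -> hg] := act_frame hm hm'.
rewrite tgt_act zone_frame // [(act m g).1]/= zone_frame //.
case: g hg => [[x y] u]; rewrite [(_, u).2]/= [(_, u).1]/= => hu hz.
have : (x \in [:: 0; 1]) && (y \in [:: -1; 0; 1]).
  by move: hz; rewrite /zone /box /= !inE; lia.
case/andP; rewrite !inE => hx hy.
move: hu; rewrite !inE => hu hz'.
suff : ((x, y), u) \in moves.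
  by move/(nthP dart0) => [k hk <-]; exists k.
by move: hx hy hu hz' {hz} => /orP[] /eqP -> /or3P[] /eqP -> /or4P[] /eqP ->.
Qed.

Lemma move_unit k : (k < 10)%N -> (move k).2 \in units.
Proof. by move=> hk; have /(all_nthP dart0)/(_ k hk) : all (fun g => g.2 \in units) moves. Qed.

(** Moving left by at most one unit per selection is what forces a chain starting at abscissa [n] to
    have at least [n] moves before it can reach negative abscissas. *)
Lemma act_shift m k : m.2 \in units -> (k < 10)%N ->
  m.1.1 - 1 <= (act m (move k)).1.1.
Proof.
move=> hm hk.
have : all (fun g : dart => [&& -1 <= g.1.1, g.1.1 <= 1, -1 <= g.1.2 & g.1.2 <= 1]) moves by [].
move/(all_nthP dart0)/(_ k hk); rewrite -/(move k).
case: m (move k) hm => [[a b] d] [[x y] u]; rewrite /= !inE.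
by move=> /or4P[] /eqP ->; rewrite /=; lia.
Qed.

Lemma zone_left m f : m.2 \in units -> zone m f -> m.1.1 - 1 <= f.1.
Proof.
case: m f => [[a b] d] [x y]; rewrite /= !inE.
by move=> /or4P[] /eqP ->; rewrite /zone /box /=; lia.
Qed.

(* End points of the edge crossed by a dart, on its left and on its right. *)
Definition endl (m : dart) : pt :=
  addp m.1 (if m.2 == (1, 0) then (1, 1) else if m.2 == (0, 1) then (0, 1)
            else if m.2 == (-1, 0) then (0, 0) else (1, 0)).
Definition endr (m : dart) : pt :=
  addp m.1 (if m.2 == (1, 0) then (1, 0) else if m.2 == (0, 1) then (1, 1)
            else if m.2 == (-1, 0) then (0, 1) else (0, 0)).

(** If the two edges shared an end point, both faces of [m'] would touch an end point of the edge of
    [m], and the target of [m'] would lie in the zone. *)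
Lemma ends_disjoint m m' : m.2 \in units -> m'.2 \in units -> ~~ zone m (tgt m') ->
  [&& endl m != endl m', endl m != endr m', endr m != endl m' & endr m != endr m'].
Proof.
case: m m' => [[a b] d] [[a' b'] d']; rewrite /= !inE.
by move=> /or4P[] /eqP -> /or4P[] /eqP ->; rewrite /zone /box /tgt /endl /endr /addp /= ?xpair_eqE /=; lia.
Qed.

(** * Chains of last exits along a path of faces *)

(** The final inclusion lets the remaining path inherit the avoidance of zones left earlier. *)
Lemma last_exit (T : eqType) (e : rel T) (P : pred T) x s :
  path e x s -> P x -> ~~ P (last x s) ->
  exists a b s', [/\ [/\ P a, e a b & path e b s'], last b s' = last x s,
    all (predC P) (b :: s') & {subset a :: b :: s' <= x :: s}].
Proof.
elim/last_ind: s => [|s y IHs] /=; first by move=> _ ->.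
rewrite last_rcons rcons_path => /andP[hs ey] Px Py.
case: (boolP (P (last x s))) => [Pl|nPl].
  exists (last x s), y, [::]; split=> //=; first by rewrite Py.
  move=> z; rewrite -rcons_cons mem_rcons in_cons inE orbC in_cons.
  by case/orP=> [->//|/eqP->]; rewrite mem_last orbT.
have [a [b [s' [[Pa eab hs'] hl hall hsub]]]] := IHs hs Px nPl.
exists a, b, (rcons s' y); split=> //.
- by rewrite rcons_path hs' hl.
- by rewrite last_rcons.
- by move: hall => /= /andP[-> h]; rewrite all_rcons h andbT.
move=> z; rewrite -!rcons_cons !mem_rcons.
by rewrite in_cons => /orP[/eqP->|/hsub h]; rewrite ?mem_head // in_cons h orbT.
Qed.

Definition trace (m : dart) (w : seq nat) : seq dart :=
  scanl (fun m k => act m (move k)) m w.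

(** The dart right after [m] starts inside [zone m] and only its target is outside; from the second
    one on, both faces are outside, whence [behead]. *)
Fixpoint separated (s : seq dart) : bool :=
  if s is m :: s' then
    [&& all (fun m' => ~~ zone m (tgt m')) s', all (off m) (behead s') & separated s']
  else true.

Definition grid_step : rel pt := fun u v => (v.1 - u.1, v.2 - u.2) \in units.

Definition dart_to (f g : pt) : dart := (f, (g.1 - f.1, g.2 - f.2)).

Lemma tgt_dart_to f g : tgt (dart_to f g) = g.
Proof. by apply: pt_eq; rewrite /tgt /=; ring. Qed.

Lemma zone_tgt m : m.2 \in units -> zone m (tgt m).
Proof.
case: m => [[a b] d]; rewrite /= !inE => /or4P[] /eqP ->;
  by rewrite /zone /box /tgt /=; lia.
Qed.

(** Induction on [n], generalised over the list [ms] of darts selected before [m], whose zones the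
    remaining path avoids. The source of the next dart lies on that path too, which gives [off] and
    not only a condition on targets. *)
Lemma exit_chain (e : rel pt) (n : nat) (m : dart) (s : seq pt) (ms : seq dart) :
  subrel e grid_step -> m.2 \in units -> path e (tgt m) s ->
  (last (tgt m) s).1 < 0 -> n%:Z <= m.1.1 ->
  {in ms, forall m0, all (fun f => ~~ zone m0 f) (tgt m :: s)} ->
  exists w, [/\ size w = n, all (gtn 10) w,
    all (fun m' => e m'.1 (tgt m')) (trace m w), separated (m :: trace m w) &
    {in ms, forall m0, all (off m0) (trace m w)}].
Proof.
move=> hE; elim: n m s ms => [|n IHn] m s ms hm hs hl hn hms; first by exists [::].
(* The zone of [m] stays at abscissas at least [m.1.1 - 1], which is nonnegative, while the path
   ends at a negative one. *)
have nl : ~~ zone m (last (tgt m) s).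
  apply/negP => /(zone_left hm) h; have := le_lt_trans h hl; have : 1 <= m.1.1 by apply: le_trans hn; rewrite lez_nat. 
  by move: m.1.1 => x; clear; lia.
have [a [b [s' [[Pa eab hs'] hl' hall hsub]]]] := last_exit hs (zone_tgt hm) nl.
pose m' : dart := dart_to a b.
have tm' : tgt m' = b by exact: tgt_dart_to.
have hm' : m'.2 \in units by exact: hE eab.
have nb : ~~ zone m (tgt m') by rewrite tm'; case/andP: hall.
have [k hk e'] := exit_move hm hm' Pa nb.
have hms' : {in m :: ms, forall m0, all (fun f => ~~ zone m0 f) (tgt m' :: s')}.
  move=> m0; rewrite inE tm' => /predU1P[->//|/hms/allP h].
  by apply/allP => f fb; apply/h/hsub; rewrite inE fb orbT.
have hs1 : path e (tgt m') s' by rewrite tm'.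
have hl1 : (last (tgt m') s').1 < 0 by rewrite tm' hl'.
have hn1 : n%:Z <= m'.1.1.
  have := act_shift hm hk; rewrite -e' => h.
  by apply: le_trans h; rewrite lerBrDr (_ : n%:Z + 1 = n.+1%:Z) //; lia.
have [w [hsz hw hwE hsep hoff]] := IHn m' s' (m :: ms) hm' hs1 hl1 hn1 hms'.
exists (k :: w); have tE : trace m (k :: w) = m' :: trace m' w by rewrite e'.
rewrite tE; split=> //=.
- by rewrite hsz.
- by rewrite hk.
- by rewrite tm' eab.
- have offm := hoff m (mem_head _ _).
  rewrite nb offm; apply/and3P; split=> //.
  by apply: sub_all offm => m0 /andP[].
move=> m0 hm0; rewrite (hoff m0) ?inE ?hm0 ?orbT // andbT /off tm'.
have /allP h := hms m0 hm0.
by rewrite !h //; apply: hsub; rewrite !inE eqxx ?orbT.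
Qed.

(** Of [separated], only the [off] conditions among four consecutive darts are kept; [off_frame]
    turns them into the tests [ok3] on moves alone. *)
Lemma separated_words w i j (m : dart) : m.2 \in units -> (i < 10)%N -> (j < 10)%N ->
  all (gtn 10) w -> separated (m :: trace m [:: i, j & w]) ->
  w \in words (size w) i j.
Proof.
elim: w i j m => [|k w IHw] i j m hm hi hj; first by rewrite inE.
case/andP=> hk hw; set m1 := act m (move i); set m2 := act m1 (move j).
set m3 := act m2 (move k).
have -> : trace m [:: i, j, k & w] = [:: m1, m2, m3 & trace m3 w] by [].
rewrite [separated _]/= => /and3P[_ /and3P[f2 f3 _] /andP[h1 /andP[h2 h3]]].
have hm1 : m1.2 \in units by rewrite act_unit ?move_unit.
have /flatten_mapP : exists2 k', k' \in [seq k <- iota 0 10 | ok3 i j k] &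
    k :: w \in [seq k' :: w' | w' <- words (size w) j k'].
  exists k; last by apply: map_f; apply: (IHw j k m1) => //=; rewrite h1 h2 h3.
  rewrite mem_filter mem_iota leq0n (hk : (k < 10)%N) !andbT /ok3 /ok2; apply/and3P; split.
  - by rewrite -(off_frame _ hm) -act_assoc.
  - by rewrite -(off_frame _ hm1) -act_assoc; case/andP: h2.
  - by rewrite -(off_frame _ hm) -!act_assoc.
by [].
Qed.

(** * Parity argument for the boundary of a bounded connected set *)

Definition separates (A : pred pt) : rel pt := fun f g =>
  grid_step f g && (A (endl (dart_to f g)) != A (endr (dart_to f g))).

Lemma separates_right A x y :
  separates A (x, y) (x + 1, y) = (A (x + 1, y + 1) != A (x + 1, y)).
Proof.
rewrite /separates /grid_step /endl /endr /dart_to /addp /=.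
by rewrite [x + 1 - x]addrC addKr subrr /= addr0.
Qed.

Lemma separates_left A x y :
  separates A (x + 1, y) (x, y) = (A (x + 1, y) != A (x + 1, y + 1)).
Proof.
rewrite /separates /grid_step /endl /endr /dart_to /addp /=.
by rewrite opprD addNKr subrr /= !addr0.
Qed.

Lemma separates_up A x y :
  separates A (x, y) (x, y + 1) = (A (x, y + 1) != A (x + 1, y + 1)).
Proof.
rewrite /separates /grid_step /endl /endr /dart_to /addp /=.
by rewrite [y + 1 - y]addrC addKr subrr /= addr0.
Qed.

Lemma separates_down A x y :
  separates A (x, y + 1) (x, y) = (A (x + 1, y + 1) != A (x, y + 1)).
Proof.
rewrite /separates /grid_step /endl /endr /dart_to /addp /=.
by rewrite opprD addNKr subrr /= !addr0.
Qed.

Lemma addb_false (a b : bool) : a (+) b = false -> a = b.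
Proof. by case: a; case: b. Qed.

Section Crossing.
Variables (A C : pred pt) (M : nat).
Hypothesis bounded_A : forall u, A u -> (`|u.1| < M%:Z) && (`|u.2| < M%:Z).
Hypothesis closed_C : forall f g, separates A f g -> C f -> C g.

Lemma closed_right x y : A (x + 1, y) != A (x + 1, y + 1) -> C (x + 1, y) = C (x, y).
Proof.
move=> h; apply/idP/idP; apply: closed_C; first by rewrite separates_left.
by rewrite separates_right eq_sym.
Qed.

Lemma closed_up x y : A (x, y + 1) != A (x + 1, y + 1) -> C (x, y + 1) = C (x, y).
Proof.
move=> h; apply/idP/idP; apply: closed_C; first by rewrite separates_down eq_sym.
by rewrite separates_up.
Qed.

(** The edge from [u] to its right neighbour is the bottom side of the face [u]. When it is a
    boundary edge, [C] agrees on its two sides, so testing [C] on the upper one suffices. *)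
Definition flip (u : pt) : bool := (A u != A (u.1 + 1, u.2)) && C u.

Fixpoint height_rec (n : nat) (y : int) : bool :=
  if n is n'.+1 then height_rec n' y (+) flip (M%:Z - n%:Z, y) else false.

(* Parity of the number of edges of the boundary of [A] crossed inside [C] by
   the horizontal ray issued from [u] to the right. *)
Definition height (u : pt) : bool := height_rec `|M%:Z - u.1|%N u.2.

Lemma height_right (x y : int) : x < M%:Z -> height (x, y) = height (x + 1, y) (+) flip (x, y).
Proof.
move=> hx; rewrite /height /=; have -> : `|M%:Z - x|%N = `|M%:Z - (x + 1)%R|%N.+1 by lia.
by rewrite /=; congr (_ (+) flip (_, _)); lia.
Qed.

(** Induction from the right, one face at a time. Around a face an even number of sides are boundary
    edges, and [C] takes the same value across each of them, so the contributions of the four sides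
    cancel. *)
Lemma height_up (x : int) (n : nat) (y : int) : x = M%:Z - n%:Z ->
  height (x, y) (+) height (x, y + 1) = (A (x, y) != A (x, y + 1)) && C (x, y).
Proof.
elim: n x => [|n IHn] x ->.
  have nA z : A (M%:Z - 0%:Z, z) = false.
    by apply/negP => /bounded_A /=; lia.
  by rewrite !nA /height subr0 subrr.
set z := M%:Z - n.+1%:Z; have e : z + 1 = M%:Z - n%:Z by rewrite /z; lia.
move: z e => {}x e; have hx : x < M%:Z by lia.
rewrite (height_right y hx) (height_right (y + 1) hx) addbACA (IHn _ e) /flip /=.
have hr := @closed_right x y; have hu := @closed_up x y.
have {hr} : A (x + 1, y) = A (x + 1, y + 1) \/ C (x + 1, y) = C (x, y).
  by case: eqP hr => [->|_ /(_ isT) ->]; [left|right].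
have {hu} : A (x, y + 1) = A (x + 1, y + 1) \/ C (x, y + 1) = C (x, y).
  by case: eqP hu => [->|_ /(_ isT) ->]; [left|right].
move: (A (x, y)) (A (x + 1, y)) (A (x, y + 1)) (A (x + 1, y + 1)).
move: (C (x, y)) (C (x + 1, y)) (C (x, y + 1)).
by move=> [] c1 c2 [] a1 a2 a3 [] -> [] ->; case: a3;
  rewrite ?andbF ?addbF //=; case: a1 a2 c1 c2 => [] [] [] [].
Qed.

Lemma height_outside y : M%:Z <= y -> forall x, height (x, y) = false.
Proof.
move=> hy x; rewrite /height /=; elim: (absz _) => //= n ->.
have nA z : A (z, y) = false by apply/negP => /bounded_A /=; lia.
by rewrite /flip !nA.
Qed.

(** An edge with both ends in [A] is not a boundary edge, so the parity does not change along it. *)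
Lemma height_local (u v : pt) : A u -> A v -> grid_step u v -> height u = height v.
Proof.
have hor (x y : int) : A (x, y) -> A (x + 1, y) -> height (x, y) = height (x + 1, y).
  move=> h1 h2; have hx : x < M%:Z by have := bounded_A h1; rewrite /=; lia.
  by rewrite height_right // /flip /= h1 h2 addbF.
have ver (x y : int) : A (x, y) -> A (x, y + 1) -> height (x, y) = height (x, y + 1).
  move=> h1 h2; have [n e] : exists n : nat, x = M%:Z - n%:Z.
    by exists `|M%:Z - x|%N; have := bounded_A h1; rewrite /=; lia.
  by apply/addb_false; rewrite (height_up _ e) h1 h2.
case: u v => [x y] [x' y'] hu hv; rewrite /grid_step !inE !xpair_eqE /= => hd.
have : [\/ x' = x + 1 /\ y' = y, x' = x /\ y' = y + 1, x = x' + 1 /\ y = y' | x = x' /\ y = y' + 1].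
  by case/or4P: hd => /andP[/eqP h1 /eqP h2]; [constructor 1|constructor 2|constructor 3|constructor 4]; lia.
case=> -[e1 e2]; subst; [exact: hor|exact: ver|apply/esym; exact: hor|apply/esym; exact: ver].
Qed.

End Crossing.

(** Connectedness of [A] is phrased as constancy of locally constant functions, to be applied to
    [height]. If no path reached [x < 0], take for [C] the faces reachable from [(m, 0)]: the height
    would be odd at [(m, 0)], hence at [(0, 0)], and this oddness could be carried outside the
    bounding square. *)
Lemma separating_path (A : pred pt) (M : nat) (m : int) :
  (forall u, A u -> (`|u.1| < M%:Z) && (`|u.2| < M%:Z)) ->
  (forall h : pt -> bool, {in A &, forall u v, grid_step u v -> h u = h v} ->
     {in A &, forall u v, h u = h v}) ->
  A (0, 0) -> A (m, 0) -> (forall x, m < x -> ~~ A (x, 0)) ->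
  exists2 s, path (separates A) (m, 0) s & (last (m, 0) s).1 < 0.
Proof.
move=> bA cA A0 Am Amax; apply: contrapT => nP.
pose C f := `[< exists2 s, path (separates A) (m, 0) s & last (m, 0) s = f >].
have clC f g : separates A f g -> C f -> C g.
  move=> fg /asboolP[s hs hl]; apply/asboolP; exists (rcons s g); last by rewrite last_rcons.
  by rewrite rcons_path hs hl.
have C_ge0 f : f.1 < 0 -> C f = false.
  by move=> hf; apply/negP => /asboolP[s hs hl]; apply: nP; exists s; rewrite ?hl.
have Cm : C (m, 0) by apply/asboolP; exists [::].
pose h := height A C M.
have hA : h (0, 0) = h (m, 0).
  by apply: cA => // u v hu hv; exact: height_local.
have hxM x : A (x, 0) -> x < M%:Z by move/bA => /=; lia.
have h_right n : m < M%:Z - n%:Z -> height_rec A C M n 0 = false.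
  elim: n => //= n IHn hn; rewrite IHn; last by lia.
  by rewrite /flip /= (negPf (Amax _ hn)) (negPf (Amax _ _)) //; lia.
(* The ray from [(m, 0)] meets a single boundary edge, the one to [(m + 1, 0)], and its upper face
   is in [C]. *)
have hm : h (m, 0).
  rewrite /h height_right ?hxM // /height /= h_right; last by have := hxM _ Am; lia.
  by rewrite /flip /= Am Cm (negPf (Amax _ _)) //; lia.
(* [C] is empty at negative abscissas, so the height changes neither from [(0, 0)] to [(-1, 0)] nor
   up the column [-1]. *)
have h_left (n : nat) : h (-1, n%:Z).
  elim: n => [|n IHn].
    rewrite /h height_right; last by have := hxM _ Am; lia.
    by rewrite /flip (C_ge0 (-1, 0)) // andbF addbF -[(_, _)]/((0, 0) : pt) -/(h _) hA.
  rewrite (_ : n.+1%:Z = n%:Z + 1); last by lia.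
  suff -> : h (-1, n%:Z + 1) = h (-1, n%:Z) by [].
  apply/esym/addb_false; have e : -1 = M%:Z - M.+1%:Z by lia.
  by rewrite (height_up bA clC _ e) (C_ge0 (-1, _)) // andbF.
by have := h_left M; rewrite /h (height_outside C bA).
Qed.

(** * From finite clusters to closed chains *)

Lemma open_adj_sym (G : graph) (w : subgraph G) u v : open_adj w u v -> open_adj w v u.
Proof. by case=> e we he; exists e => //; rewrite setUC. Qed.

Lemma open_adj_adj (G : graph) (w : subgraph G) u v : open_adj w u v -> adj u v.
Proof.
case=> e we huv; have [u' [v' [uv' ev]]] : edges (val e) by apply: set_mem; exact: valP.
have {ev}huv : [set u'; v'] = [set u; v] by rewrite -ev.
have [hu hv] : [set u'; v'] u /\ [set u'; v'] v by rewrite huv; split; [left|right].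
have [hu' hv'] : [set u; v] u' /\ [set u; v] v' by rewrite -huv; split; [left|right].
case: hu => /= eu; case: hv => /= ev; case: hu' => /= eu'; case: hv' => /= ev'; subst=> //.
all: by [rewrite adj_sym | rewrite adj_irr in uv'].
Qed.

Lemma Z2_adj_step (u v : pt) : Z2_adj u v -> grid_step u v.
Proof.
rewrite /Z2_adj /grid_step -(opprB v.1) -(opprB v.2) !sqrrN.
move: (v.1 - u.1) (v.2 - u.2) => x y /eqP h.
have hx : x ^+ 2 <= 1 by have := sqr_ge0 y; lia.
have hy : y ^+ 2 <= 1 by have := sqr_ge0 x; lia.
have {}hx : x \in [:: -1; 0; 1] by rewrite !inE; nia.
have {}hy : y \in [:: -1; 0; 1] by rewrite !inE; nia.
by move: hx hy h; rewrite !inE => /or3P[] /eqP -> /or3P[] /eqP ->.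
Qed.

Lemma component_step (G : graph) (w : subgraph G) (u v x : G) :
  component w u v -> open_adj w v x -> component w u x.
Proof.
move=> [s hs hl] vx; exists (rcons s x); last by rewrite last_rcons.
by rewrite rcons_path hs hl; apply/asboolP.
Qed.

Definition closed_dart (m : dart) : set (subgraph Z2) :=
  [set w | ~ open_adj w (endl m : Z2) (endr m)].

(** Crosses the edge from [(m, 0)] to [(m + 1, 0)] upwards, into the face where [separating_path]
    begins. *)
Definition start (m : int) : dart := ((m, -1), (0, 1)).

Definition clusters (w : subgraph Z2) (N : nat) : pred pt :=
  fun u => `[< exists2 x : nat, (x <= N)%N & component w ((x%:Z, 0) : Z2) u >].

Section Chain.
Variables (w : subgraph Z2) (N : nat).
Hypothesis finite_w : forall u : Z2, finite_set (component w u).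

Let A := clusters w N.

Lemma open_clusters (u v : Z2) : open_adj w u v -> A u = A v.
Proof.
suff h (x y : Z2) : open_adj w x y -> A x -> A y.
  by move=> uv; apply/idP/idP; apply: h; [|apply: open_adj_sym].
by move=> xy /asboolP[n hn hc]; apply/asboolP; exists n => //; exact: component_step hc xy.
Qed.

Lemma base_clusters (n : nat) : (n <= N)%N -> A (n%:Z, 0).
Proof. by move=> hn; apply/asboolP; exists n => //; exists [::]. Qed.

Lemma bounded_clusters : exists M : nat, forall u, A u -> (`|u.1| < M%:Z) && (`|u.2| < M%:Z).
Proof.
have : finite_set (\bigcup_(n in `I_N.+1) component w ((n%:Z, 0) : Z2)).
  by apply: bigcup_finite => // n _.
move=> /finite_seqP[s hs].
exists (\sum_(u <- s) (`|u.1|%N + `|u.2|%N)).+1 => u /asboolP[n hn hc].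
have us : u \in s.
  have : [set` s] u by rewrite -hs; exists n.
  by [].
have : (`|u.1|%N + `|u.2|%N <= \sum_(u <- s) (`|u.1|%N + `|u.2|%N))%N.
  by rewrite (big_rem u us) /= leq_addr.
lia.
Qed.

(** Each cluster is connected by open edges, and different clusters are linked along the axis, where
    edges may be closed: only adjacency in the lattice matters here. *)
Lemma connected_clusters (h : pt -> bool) : {in A &, forall u v, grid_step u v -> h u = h v} ->
  {in A &, forall u v, h u = h v}.
Proof.
move=> hloc; suff h0 u : A u -> h u = h (0, 0).
  by move=> u v hu hv; rewrite !h0.
have hbase n : (n <= N)%N -> h (n%:Z, 0) = h (0, 0).
  elim: n => // n IHn hn; rewrite -IHn ?(ltnW hn) //.
  apply: hloc; rewrite ?base_clusters ?(ltnW hn) //.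
    exact: base_clusters. exact: base_clusters (ltnW hn).
  by rewrite /grid_step /= subrr -opprB; have -> : n.+1%:Z - n%:Z = 1 by lia.
case/asboolP=> n hn [s hs hl]; rewrite -(hbase n hn) -hl {u hl}.
have := base_clusters hn; elim: s ((n%:Z, 0) : Z2) hs => //= y s IHs x /andP[/asboolP xy hs] Ax.
have Ay : A y by rewrite -(open_clusters xy).
rewrite IHs //; apply: hloc => //.
exact: Z2_adj_step (open_adj_adj (open_adj_sym xy)).
Qed.

Lemma closed_separates f g : separates A f g -> closed_dart (dart_to f g) w.
Proof. by case/andP=> _ /eqP h /open_clusters. Qed.

Lemma closed_chain : exists m : nat, (N <= m)%N /\ exists2 s : seq nat,
  size s = m /\ all (gtn 10) s &
  separated (start m :: trace (start m) s) /\
  {in start m :: trace (start m) s, forall d, closed_dart d w}.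
Proof.
have [M bA] := bounded_clusters.
pose P (n : nat) := A (n%:Z, 0).
have [||m Pm Pmax] := @ex_maxnP P M.
- by exists N; exact: base_clusters.
- by move=> n /bA /=; lia.
exists m; split; first exact/Pmax/base_clusters.
have Amax (x : int) : m%:Z < x -> ~~ A (x, 0).
  move=> hx; apply/negP => hA; have e : x = `|x|%N%:Z by lia.
  by have := Pmax `|x|%N; rewrite /P -e => /(_ hA); lia.
have [s hs hl] := separating_path bA connected_clusters (base_clusters (leq0n N)) Pm Amax.
have t0 : tgt (start m) = (m%:Z, 0) by apply: pt_eq; rewrite /tgt /=; lia.
have [||||||t [szt ht tA tsep _]] := @exit_chain (separates A) m (start m) s [::].
- by move=> f g /andP[].
- by [].
- by rewrite t0.
- by rewrite t0.
- by [].
- by [].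
(* The starting dart is not a step of the path; its edge is closed by maximality of [m]. *)
exists t => //; split=> // d; rewrite inE => /predU1P[->|/(allP tA)].
  rewrite /closed_dart /= => /open_clusters.
  have -> : endl (start m) = (m%:Z, 0) by apply: pt_eq => //=; lia.
  have -> : endr (start m) = (m%:Z + 1, 0) by apply: pt_eq.
  by rewrite (Pm : A (m%:Z, 0)) (negPf (Amax _ _)) //; lia.
move/closed_separates; congr closed_dart.
by case: d => a d; rewrite /dart_to /tgt /=; congr (_, _); apply: pt_eq => /=; ring.
Qed.
End Chain.

(** * Measurability of the percolation event *)

Lemma measurable_edge_open (G : graph) (e : edge G) :
  measurable (edge_open e : set (subgraph_space G)).
Proof. by apply: sub_sigma_algebra; exists e. Qed.

Lemma measurable_open_adj (G : graph) (u v : G) :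
  measurable ([set w | open_adj w u v] : set (subgraph_space G)).
Proof.
have [[e he]|ne] := pselect (exists e : edge G, val e = [set u; v]).
  rewrite (_ : [set w | _] = edge_open e); first exact: measurable_edge_open.
  apply/seteqP; split=> w /=; last by exists e.
  by case=> f wf hf; rewrite /edge_open /= (_ : e = f) //; apply: val_inj; rewrite hf.
rewrite (_ : [set w | _] = set0) //; apply/seteqP; split=> // w [e _ he].
by apply: ne; exists e.
Qed.

Lemma measurable_path (G : graph) (u : G) (s : seq G) :
  measurable ([set w : subgraph G | path (fun x y => `[< open_adj w x y >]) u s]
    : set (subgraph_space G)).
Proof.
elim: s u => [|v s IHs] u /=.
  by rewrite (_ : mkset _ = setT) //; apply/seteqP.
rewrite (_ : mkset _ = [set w | open_adj w u v] `&`
  [set w : subgraph G | path (fun x y => `[< open_adj w x y >]) v s]).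
  exact: measurableI (measurable_open_adj u v) (IHs v).
by apply/seteqP; split=> w /=; [case/andP=> /asboolP|case=> /asboolP -> ->].
Qed.

Lemma measurable_component (G : graph) (u v : G) :
  measurable ([set w | component w u v] : set (subgraph_space G)).
Proof.
rewrite (_ : mkset _ = \bigcup_(s : seq G) ([set w : subgraph G |
    path (fun x y => `[< open_adj w x y >]) u s] `&` [set _ | last u s = v])).
  apply: countable_bigcupT_measurable => // s.
  apply: measurableI; first exact: measurable_path.
  by case: (pselect (last u s = v)) => h;
     [rewrite (_ : mkset _ = setT)|rewrite (_ : mkset _ = set0)] => //;
     apply/seteqP; split.
apply/seteqP; split=> w /=.
  by case=> s hs hl; exists s.
by case=> s _ [hs hl]; exists s.
Qed.

(** Quantifying over finite sequences, which form a countable type when [T] does, expresses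
    infiniteness by countable unions and intersections. *)
Lemma infinite_setP (T : choiceType) (A : set T) :
  infinite_set A <-> forall s : seq T, exists2 v, v \notin s & A v.
Proof.
split=> [iA s|h /finite_seqP[s As]]; last first.
  by have [v vs] := h s; rewrite As /= (negPf vs).
apply: contrapT => h; apply: iA; apply: (@sub_finite_set _ _ [set` s]) => // v Av.
by apply/negPn/negP => vs; apply: h; exists v.
Qed.

Lemma measurable_percolation (G : graph) :
  measurable (@percolation_event G : set (subgraph_space G)).
Proof.
rewrite (_ : @percolation_event G = \bigcup_(u : G) \bigcap_(s : seq G)
    \bigcup_(v : G) ([set w | component w u v] `&` [set _ | v \notin s])).
  apply: countable_bigcupT_measurable => // u.
  rewrite -[X in measurable X]setCK setC_bigcap; apply: measurableC.
  apply: countable_bigcupT_measurable => // s; apply: measurableC.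
  apply: countable_bigcupT_measurable => // v.
  apply: measurableI; first exact: measurable_component.
  by case: (boolP (v \notin s)) => h;
     [rewrite (_ : mkset _ = setT)|rewrite (_ : mkset _ = set0)] => //;
     apply/seteqP; split.
apply/seteqP; split=> w /=.
  by case=> u /infinite_setP h; exists u => // s _; have [v] := h s; exists v.
case=> u _ h; exists u; apply/infinite_setP => s.
by have [v _ [? ?]] := h s I; exists v.
Qed.

(** * Probability that all edges of a separated chain are closed *)

Lemma Z2_edge (m : dart) : m.2 \in units ->
  exists e : edge Z2, val e = [set (endl m : Z2); endr m].
Proof.
move=> hm; have h : edges ([set (endl m : Z2); endr m]).
  exists (endl m), (endr m); split=> //.
  case: m hm => [[a b] d]; rewrite /= !inE.
  by move=> /or4P[] /eqP ->; rewrite /endl /endr /addp /adj /= /Z2_adj /=; apply/eqP; ring.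
by exists (exist (fun e => e \in @edges Z2) _ (mem_set h)).
Qed.

Lemma closed_dartE (m : dart) (e : edge Z2) : val e = [set (endl m : Z2); endr m] ->
  closed_dart m = ~` edge_open e.
Proof.
move=> he; apply/seteqP; split=> w /=; first by move=> h we; apply: h; exists e.
by move=> h [f wf hf]; apply: h; rewrite /edge_open /= (_ : e = f) //; apply: val_inj; rewrite hf.
Qed.

Definition closed_darts (s : seq dart) : set (subgraph Z2) :=
  \big[setI/setT]_(m <- s) closed_dart m.

Definition dart_edges (s : seq dart) : set (edge Z2) :=
  [set e | exists2 m, m \in s & val e = [set (endl m : Z2); endr m]].

(** Serves twice: all edges for [S] gives measurability, [dart_edges s] gives the sigma-algebra
    needed for 1-independence. *)
Lemma closed_darts_sigma (s : seq dart) (S : set (edge Z2)) :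
  {in s, forall m, m.2 \in units} -> dart_edges s `<=` S ->
  <<s edge_events S >> (closed_darts s).
Proof.
move=> hs sS; suff : measurable (closed_darts s : set (g_sigma_algebraType (edge_events S))) by [].
rewrite /closed_darts big_seq; apply: big_ind => //.
- by move=> A B; exact: measurableI.
move=> m ms; have [e he] := Z2_edge (hs m ms).
rewrite (closed_dartE he); apply: measurableC; apply: sub_sigma_algebra; exists e => //.
by apply: sS; exists m.
Qed.

Lemma measurable_closed_darts (s : seq dart) : {in s, forall m, m.2 \in units} ->
  measurable (closed_darts s : set (subgraph_space Z2)).
Proof. by move=> hs; exact: (closed_darts_sigma hs). Qed.

(** The first edge shares no vertex with the later ones by [ends_disjoint], so 1-independence splits
    off a factor [q]. *)
Lemma closed_darts_le (R : realType) (P : bond_model R Z2) (q : R) (s : seq dart) :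
  0 <= q -> one_independent P ->
  (forall e : edge Z2, ((1 - q)%:E <= P (edge_open e))%E) ->
  {in s, forall m, m.2 \in units} -> separated s ->
  (P (closed_darts s) <= (q ^+ size s)%:E)%E.
Proof.
move=> q0 iP oP; elim: s => [|m s IHs] hs.
  by move=> _; rewrite /closed_darts big_nil probability_setT.
case/and3P => /allP hsep _ /IHs{}IHs.
have hm : m.2 \in units by apply: hs; rewrite mem_head.
have {}hs : {in s, forall m, m.2 \in units} by move=> d ds; apply: hs; rewrite inE ds orbT.
have [e he] := Z2_edge hm.
have disj (f : edge Z2) : dart_edges s f -> val e `&` val f = set0.
  case=> d ds hf; rewrite he hf; have := ends_disjoint hm (hs d ds) (hsep d ds).
  case/and4P => /eqP h1 /eqP h2 /eqP h3 /eqP h4.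
  by apply/seteqP; split=> // x [[->|->]] [] => [/h1|/h2|/h3|/h4].
rewrite /closed_darts big_cons (iP [set e] (dart_edges s)).
- rewrite exprS EFinM; apply: lee_pmul => //; last exact: IHs.
  rewrite (closed_dartE he) probability_setC; last exact: measurable_edge_open.
  have fP : P (edge_open e) \is a fin_num by apply: fin_num_measure; exact: measurable_edge_open.
  by have := oP e; rewrite -(fineK fP) -EFinB !lee_fin lerBlDr lerBlDl addrC.
- apply/seteqP; split=> // f [/= -> /disj]; rewrite setIid he => h.
  by have : set0 (endl m) by rewrite -h; left.
- by move=> _ f -> /disj.
- by rewrite (closed_dartE he); apply: sigma_algebraC; apply: sub_sigma_algebra; exists e.
- exact: closed_darts_sigma.
Qed.

Lemma trace_unit (m : dart) w : m.2 \in units -> all (gtn 10) w ->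
  {in m :: trace m w, forall d, d.2 \in units}.
Proof.
elim: w m => [|k w IHw] m hm /=; first by move=> _ d; rewrite inE => /eqP ->.
case/andP=> hk hw d; rewrite inE => /predU1P[->//|].
by apply: IHw => //; rewrite act_unit ?move_unit.
Qed.

(** * Union bound and Borel-Cantelli *)

Definition start_words (n : nat) : seq (seq nat) :=
  flatten [seq flatten [seq [seq [:: i, j & w] | w <- words n i j] | j <- iota 0 10]
    | i <- iota 0 10].

(** The constant is 100 choices for the first two moves times the largest weight, 11. *)
Lemma size_start_words n : (5 ^ n * size (start_words n) <= 1100 * 32 ^ n)%N.
Proof.
have -> : size (start_words n) =
    \sum_(0 <= i < 10) \sum_(0 <= j < 10) size (words n i j).
  rewrite size_flatten /shape -map_comp sumnE big_map; apply: eq_bigr => i _.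
  rewrite [LHS]size_flatten /shape -map_comp sumnE big_map; apply: eq_bigr => j _.
  by rewrite [LHS]size_map.
rewrite big_distrr /=; apply: (@leq_trans (\sum_(0 <= i < 10) 110 * 32 ^ n)%N); last first.
  by rewrite sum_nat_const_nat mulnA.
rewrite big_seq [X in (_ <= X)%N]big_seq; apply: leq_sum => i; rewrite mem_index_iota => /andP[_ hi].
rewrite big_distrr /=; apply: (@leq_trans (\sum_(0 <= j < 10) 11 * 32 ^ n)%N); last first.
  by rewrite sum_nat_const_nat mulnA.
rewrite big_seq [X in (_ <= X)%N]big_seq; apply: leq_sum => j; rewrite mem_index_iota => /andP[_ hj].
by apply: leq_trans (size_words n hi hj) _; rewrite mulnC leq_mul2r weight_le orbT.
Qed.

Definition start_chain (n : nat) (s : seq nat) : seq dart :=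
  start n.+2%:Z :: trace (start n.+2%:Z) s.

(** The shift by two accounts for the two free moves that precede the [n] counted by [words]. *)
Definition exit_event (n : nat) : set (subgraph_space Z2) :=
  \big[setU/set0]_(s <- start_words n |
      [&& all (gtn 10) s, size s == n.+2 & separated (start_chain n s)])
    closed_darts (start_chain n s).

Lemma not_percolation_sub :
  ~` @percolation_event Z2 `<=` lim_sup_set exit_event.
Proof.
move=> w nw N _; have fw u : finite_set (component w u).
  by apply: contrapT => h; apply: nw; exists u.
(* Asking for [m >= N + 2] yields [m = n + 2] with [n >= N], hence exit events of arbitrarily large
   index. *)
have [m [hm [s [szs hs] [hsep hcl]]]] := closed_chain N.+2 fw.
case: m hm szs hsep hcl => [|[|n]] // hm szs hsep hcl.
exists n => //; rewrite /exit_event -bigcup_seq_cond.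
exists s; last by rewrite /closed_darts -bigcap_seq => d hd; exact: hcl.
apply/andP; split; last by apply/and3P; split; rewrite ?szs.
case: s szs hs hsep {hcl} => [|i [|j s]] // [szs] /and3P[hi hj hs] hsep.
apply/flatten_mapP; exists i; first by rewrite mem_iota.
apply/flatten_mapP; exists j; first by rewrite mem_iota.
by apply: map_f; rewrite -szs; apply: (separated_words _ hi hj hs hsep).
Qed.

Lemma closed_chain_unit n s : all (gtn 10) s ->
  {in start_chain n s, forall m, m.2 \in units}.
Proof. exact: trace_unit. Qed.

Lemma measurable_exit_event n : measurable (exit_event n).
Proof.
apply: bigsetU_measurable => s /andP[hs _].
by apply: measurable_closed_darts; exact: closed_chain_unit.
Qed.

Section Bound.
Variables (R : realType) (P : bond_model R Z2).
Hypothesis iP : one_independent P.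
Hypothesis oP : forall e : edge Z2, ((8457 / 10000)%:E <= P (edge_open e))%E.

Let q : R := 1543 / 10000.
Let r : R := 32 / 5 * q.

Lemma exit_event_le n : (P (exit_event n) <= (1100 * r ^+ n)%:E)%E.
Proof.
have q0 : 0 <= q by rewrite /q; lra.
have q1 : q <= 1 by rewrite /q; lra.
pose good (s : seq nat) := [&& all (gtn 10) s, size s == n.+2 & separated (start_chain n s)].
apply: (@le_trans _ _ (\sum_(s <- start_words n) (q ^+ n)%:E)%E).
  rewrite [X in (_ <= X)%E](bigID good) /=.
  apply: le_trans (leeDl _ _); last by apply: sume_ge0 => s _; rewrite lee_fin exprn_ge0.
  (* Measurability is carried along because subadditivity requires it at each union. *)
  pose K (X : set (subgraph_space Z2)) (y : \bar R) := measurable X /\ (P X <= y)%E.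
  suff [] : K (exit_event n) (\sum_(s <- start_words n | good s) (q ^+ n)%:E)%E by [].
  apply: big_ind2.
  - by split=> //; rewrite measure0.
  - move=> X x Y y [mX hX] [mY hY]; split; first exact: measurableU.
    exact: le_trans (measureU2 _ _ _) (leeD hX hY).
  move=> s /and3P[hs /eqP szs hsep].
  have hu := @closed_chain_unit n s hs.
  split; first exact: measurable_closed_darts.
  apply: (le_trans (closed_darts_le q0 iP _ hu hsep)).
    by move=> e; apply: le_trans (oP e); rewrite lee_fin /q; lra.
  (* The chain has [n + 3] edges; three factors [q] are bounded by 1. *)
  rewrite lee_fin /= size_scanl szs (_ : n.+3 = (3 + n)%N) // exprD ler_piMl ?exprn_ge0 //.
  by rewrite exprn_ile1.
rewrite sumEFin lee_fin big_const_seq count_predT iter_addr_0 -[leLHS]mulr_natl.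
have {q0 q1} : 0 < q by rewrite /q; lra.
rewrite /r; move: q => a a0; rewrite (exprMn _ _ a) [X in _ <= X]mulrA ler_pM2r ?exprn_gt0 //.
rewrite exprMn exprVn mulrA ler_pdivlMr ?exprn_gt0 // mulrC -!natrX -!natrM ler_nat.
exact: size_start_words.
Qed.

Lemma percolation_eq1 : P (@percolation_event Z2) = 1%E.
Proof.
have mp := @measurable_percolation Z2.
suff : P (~` @percolation_event Z2) = 0%E.
  rewrite probability_setC // // -(fineK (fin_num_measure P _ mp)) -EFinB.
  by move=> [/eqP]; rewrite subr_eq0 => /eqP <-.
have mexit := measurable_exit_event.
apply/eqP; rewrite eq_le measure_ge0 andbT.
rewrite -(@lim_sup_set_cvg0 _ _ _ P exit_event) //.
  apply: le_measure; rewrite ?inE; [exact: measurableC| |exact: not_percolation_sub].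
  by apply: bigcap_measurable => // k _; exact: bigcup_measurable.
(* Here [r = 6.4 * 0.1543 = 0.98752], so the probabilities of the exit events are summable. *)
have r1 : `|r| < 1 by rewrite ger0_norm /r /q; lra.
apply: (@le_lt_trans _ _ (\sum_(n <oo) (geometric 1100 r n)%:E)%E).
  apply: lee_nneseries => [n _ _|n _]; first exact: measure_ge0.
  exact: exit_event_le.
rewrite (_ : (fun n => _) = EFin \o series (geometric 1100 r)); last first.
  by apply/funext => n /=; rewrite sumEFin.
by rewrite EFin_lim ?ltry //; exact: is_cvg_geometric_series.
Qed.

End Bound.

Theorem theorem1p3 (R : realType) :
  (p_max R Z2 <= (8457 / 10000)%:E)%E.
Proof.
apply: ge_ereal_sup => _ [p [P [iP oP] nP] <-]; rewrite lee_fin leNgt.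
apply/negP => hp; apply: nP; rewrite /percolates percolation_eq1 ?lte01 //.
by move=> e; apply: le_trans (oP e); rewrite lee_fin ltW.
Qed.
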